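(* Let $k,h,d,n$ be positive integers, let $\star\in\{F,\mathcal N\}$, with $n=3$ in the case $\star=\mathcal N$, and let $V\in M(h,d)$ have rows $\mathbf v_1,\dots,\mathbf v_h\in\mathbb R^d$. Consider the function $\mathcal L_\star:M(k,d)\to\mathbb R$, $$\mathcal L_\star(W)=\Big\|\sum_{i=1}^k \mathbf w_i^{\otimes n}-\sum_{i=1}^h \mathbf v_i^{\otimes n}\Big\|_\star^2,$$ where $\mathbf w_1,\dots,\mathbf w_k$ are the rows of $W$. If $\sigma\in S_h$ and $\rho\in S_d$ are such that $VP_\rho=P_\sigma V$, then $\mathcal L_\star(W)=\mathcal L_\star(WP_\rho)$ for all $W\in M(k,d)$.
   Context: $M(k,d)$ is the space of real $k\times d$ matrices. For a permutation $\pi$ of $\{1,\dots,m\}$, $P_\pi$ is the $m\times m$ permutation matrix with $(P_\pi)_{ij}=1$ if $i=\pi(j)$ and $0$ otherwise. For $\mathbf v\in\mathbb R^d$, $\mathbf v^{\otimes n}$ is the order-$n$ tensor with entries $(\mathbf v^{\otimes n})_{i_1,\dots,i_n}=v_{i_1}\cdots v_{i_n}$. A tensor in $(\mathbb R^d)^{\otimes n}$ is symmetric if its entries are invariant under permutation of the indices; the space of these is denoted $S^n(\mathbb R^d)$. The Frobenius inner product is $\langle T,S\rangle_F=\sum_{i_1,\dots,i_n}T_{i_1\dots i_n}S_{i_1\dots i_n}$. The cubic-Gaussian inner product on $S^3(\mathbb R^d)$ is $\langle S,T\rangle_{\mathcal N}=\mathbb E_{\mathbf x\sim\mathcal N(0,I_d)}[\langle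 S,\mathbf x^{\otimes 3}\rangle_F\langle T,\mathbf x^{\otimes 3}\rangle_F]$. The norm $\|\cdot\|_\star$ is the one induced by $\langle\cdot,\cdot\rangle_\star$ on symmetric tensors. *)

(* Defs.v *)
From HB Require Import structures.
From mathcomp Require Import all_boot all_order all_algebra all_fingroup.
From mathcomp Require Import all_classical all_reals all_analysis.

Set Implicit Arguments.
Unset Strict Implicit.
Unset Printing Implicit Defensive.

Import Order.TTheory GRing.Theory Num.Theory.

Local Open Scope classical_set_scope.
Local Open Scope ring_scope.

(* This is the transpose of the library's [perm_mx pi]. *)
Definition permutation_matrix (R : realType) (m : nat) (pi : 'S_m) : 'M[R]_m :=
  \matrix_(i, j) (i == pi j)%:R.

Section Tensors.
Variables (R : realType) (d n : nat).

Definition tensor := {ffun {ffun 'I_n -> 'I_d} -> R}.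

Definition symmetric_tensor (T : tensor) : Prop :=
  forall (s : 'S_n) (i : {ffun 'I_n -> 'I_d}), T [ffun a => i (s a)] = T i.

Definition tensor_power (v : 'rV[R]_d) : tensor :=
  [ffun i : {ffun 'I_n -> 'I_d} => \prod_(a < n) v ord0 (i a)].

Definition frobenius_inner (S T : tensor) : R := \sum_i S i * T i.

Definition residual k h (V : 'M[R]_(h, d)) (W : 'M[R]_(k, d)) : tensor :=
  \sum_(i < k) tensor_power (row i W) - \sum_(i < h) tensor_power (row i V).

Lemma tensor_power_symmetric v : symmetric_tensor (tensor_power v).
Proof.
move=> s i; rewrite !ffunE [RHS](reindex_inj (@perm_inj _ s)) /=.
by apply: eq_bigr => a _; rewrite ffunE.
Qed.

Lemma residual_symmetric k h (V : 'M[R]_(h, d)) (W : 'M[R]_(k, d)) :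
  symmetric_tensor (residual V W).
Proof.
have sumE p (A : 'M[R]_(p, d)) i :
    (\sum_(j < p) tensor_power (row j A) : tensor) i =
    \sum_(j < p) tensor_power (row j A) i.
  by rewrite sum_ffunE.
move=> s i; rewrite /residual !ffunE !sumE.
by congr (_ - _); apply: eq_bigr => j _; rewrite tensor_power_symmetric.
Qed.

End Tensors.

Section StandardGaussian.
Variable R : realType.

Definition cons_tuple d (x : measurableTypeR R * d.-tuple (measurableTypeR R)) :
  d.+1.-tuple (measurableTypeR R) := [tuple of x.1 :: x.2].

Lemma measurable_cons_tuple d : measurable_fun [set: _] (@cons_tuple d).
Proof. exact: measurable_cons. Qed.

HB.instance Definition _ d :=
  isMeasurableFun.Build _ _ _ _ (@cons_tuple d) (@measurable_cons_tuple d).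

(* N(0, I_d) as the d-fold product of N(0, 1), transported from nested pairs to
   d-tuples. *)
Fixpoint standard_gaussian d : probability (d.-tuple (measurableTypeR R)) R :=
  if d is e.+1 then
    distribution (normal_prob (0 : R) 1 \x standard_gaussian e)%E (@cons_tuple e)
  else \d_ [tuple].

Lemma standard_gaussian_box d (A : 'I_d -> set (measurableTypeR R)) :
  (forall i, measurable (A i)) ->
  standard_gaussian d [set x | forall i, A i (tnth x i)] =
  (\prod_(i < d) normal_prob (0 : R) 1 (A i))%E.
Proof.
elim: d A => [|d IH] A mA.
  rewrite big_ord0 /= diracE mem_set// => -[] //.
rewrite big_ord_recl -IH => [|i]; last exact: mA.
rewrite /= /distribution /pushforward -product_measure1E//.
  congr (product_measure1 _ _ _); apply/seteqP; split=> [[x y]|[x y] []] /=.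
    move=> H; split; first by have := H ord0.
    by move=> i; have := H (lift ord0 i); rewrite tnthS.
  move=> Ax Ay i; case: (unliftP ord0 i) => [j|] ->//.
  by rewrite tnthS.
rewrite (_ : [set x | _] = \bigcap_(i in [set: 'I_d])
    ((fun x => tnth x i) @^-1` A (lift ord0 i))).
  apply: fin_bigcap_measurable => // i _.
  by rewrite -[X in measurable X]setTI; apply: measurable_tnth.
by apply/seteqP; split=> x /= H i; [move=> _|]; exact: H.
Qed.

End StandardGaussian.

Section InnerProducts.
Variables (R : realType) (d : nat).

(* [fine] loses nothing: the integrand is a polynomial in the Gaussian
   coordinates, so it is integrable. On non-symmetric tensors the form is only
   positive semidefinite; [loss] applies it to symmetric ones, by
   [residual_symmetric]. *)
Definition gaussian_inner (S T : tensor R d 3) : R :=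
  fine 'E_(standard_gaussian R d)[fun x =>
    (frobenius_inner S (tensor_power 3 (\row_j tnth x j)) *
     frobenius_inner T (tensor_power 3 (\row_j tnth x j)))%R].

(* Indexing by the tensor order makes [CubicGaussian] available only at n = 3. *)
Inductive inner_choice : nat -> Type :=
  | Frobenius n : inner_choice n
  | CubicGaussian : inner_choice 3.

Definition inner n (star : inner_choice n) : tensor R d n -> tensor R d n -> R :=
  match star in inner_choice m return tensor R d m -> tensor R d m -> R with
  | Frobenius m => @frobenius_inner R d m
  | CubicGaussian => gaussian_inner
  end.

Definition tensor_norm n (star : inner_choice n) (T : tensor R d n) : R :=
  Num.sqrt (inner star T T).

Definition loss n (star : inner_choice n) k h
    (V : 'M[R]_(h, d)) (W : 'M[R]_(k, d)) : R :=
  tensor_norm star (residual n V W) ^+ 2.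

End InnerProducts.

(* Main.v *)
From HB Require Import structures.
Require Import Defs.
From mathcomp Require Import all_boot all_order all_algebra all_fingroup.
From mathcomp Require Import all_classical all_reals all_analysis.
From mathcomp Require Import measurable_realfun.

Import Order.TTheory GRing.Theory Num.Theory.

Local Open Scope ring_scope.

(** Right multiplication by [permutation_matrix R rho] permutes the coordinates
    of every row, hence acts on tensors by relabelling the entries of their
    multi-indices ([permute_tensor]). Left multiplication only reorders the
    rows, which a sum over the rows does not see. Writing [P] and [Q] for the
    permutation matrices of [rho] and [sigma], the assumption [V P = Q V] shows
    that the target of the residual is its own relabelling, so that
    [residual n V (W P)] is the relabelled [residual n V W]
    ([residual_mul_permutation], [residual_row_permutation]).

    It remains that both norms are invariant under relabelling
    ([tensor_norm_permute]). For the Frobenius norm this is a reindexing of the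
    sum. For the cubic-Gaussian norm, relabelling can be moved by Frobenius
    invariance from the tensor to the Gaussian vector, and the law N(0, I_d)
    does not change when the coordinates are permuted
    ([standard_gaussian_permute]): the two laws agree on boxes, which are
    stable under intersection and generate the measurable sets. *)

(** * Permutation matrices and relabelled tensors *)

Section PermuteTensor.
Variables (R : realType) (d : nat).

Lemma permutation_matrixE m (pi : 'S_m) :
  permutation_matrix R pi = perm_mx (pi^-1)%g.
Proof. by apply/matrixP => i j; rewrite !mxE (canF_eq (permKV pi)). Qed.

Lemma mul_permutation_matrix k (A : 'M[R]_(k, d)) (rho : 'S_d) :
  A *m permutation_matrix R rho = col_perm rho A.
Proof. by rewrite permutation_matrixE col_permE. Qed.

Lemma permutation_matrix_mul k (A : 'M[R]_(k, d)) (sigma : 'S_k) :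
  permutation_matrix R sigma *m A = row_perm (sigma^-1)%g A.
Proof. by rewrite permutation_matrixE row_permE. Qed.

Definition permute_tensor n (rho : 'S_d) (T : tensor R d n) : tensor R d n :=
  [ffun i : {ffun 'I_n -> 'I_d} => T [ffun a => rho (i a)]].
Arguments permute_tensor {n}.

Lemma tensor_power_col_perm n (rho : 'S_d) (v : 'rV[R]_d) :
  tensor_power n (col_perm rho v) = permute_tensor rho (tensor_power n v).
Proof.
apply/ffunP => i; rewrite !ffunE.
by apply: eq_bigr => a _; rewrite mxE ffunE.
Qed.

Lemma residual_mul_permutation n k h (rho : 'S_d)
    (V : 'M[R]_(h, d)) (W : 'M[R]_(k, d)) :
  residual n (V *m permutation_matrix R rho) (W *m permutation_matrix R rho) =
  permute_tensor rho (residual n V W).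
Proof.
have permute_sum p (A : 'M[R]_(p, d)) i :
    (\sum_(j < p) tensor_power n (row j (col_perm rho A)) : tensor R d n) i =
    (\sum_(j < p) tensor_power n (row j A) : tensor R d n) [ffun a => rho (i a)].
  rewrite !sum_ffunE; apply: eq_bigr => j _.
  have -> : row j (col_perm rho A) = col_perm rho (row j A).
    by apply/rowP => l; rewrite !mxE.
  by rewrite tensor_power_col_perm ffunE.
rewrite !mul_permutation_matrix; apply/ffunP => i.
by rewrite ffunE /residual !ffunE !permute_sum.
Qed.

Lemma residual_row_permutation n k h (sigma : 'S_h)
    (V : 'M[R]_(h, d)) (W : 'M[R]_(k, d)) :
  residual n (permutation_matrix R sigma *m V) W = residual n V W.
Proof.
rewrite permutation_matrix_mul /residual; congr (_ - _).
rewrite [RHS](reindex_inj (@perm_inj _ (sigma^-1)%g)) /=.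
apply: eq_bigr => j _; congr tensor_power.
by apply/rowP => l; rewrite !mxE.
Qed.

Lemma frobenius_inner_permute n (rho : 'S_d) (S T : tensor R d n) :
  frobenius_inner (permute_tensor rho S) (permute_tensor rho T) =
  frobenius_inner S T.
Proof.
pose relabel (s : 'S_d) (i : {ffun 'I_n -> 'I_d}) : {ffun 'I_n -> 'I_d} :=
  [ffun a => s (i a)].
have relabelK : cancel (relabel rho) (relabel (rho^-1)%g).
  by move=> i; apply/ffunP => a; rewrite !ffunE permK.
rewrite /frobenius_inner [RHS](reindex_inj (can_inj relabelK)) /=.
by apply: eq_bigr => i _; rewrite !ffunE.
Qed.

(** Permutations act on tensors by isometries, so acting on one argument is the
    same as acting on the other by the inverse. *)
Lemma frobenius_inner_permute_power n (rho : 'S_d) (T : tensor R d n) v :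
  frobenius_inner (permute_tensor rho T) (tensor_power n v) =
  frobenius_inner T (tensor_power n (col_perm (rho^-1)%g v)).
Proof.
rewrite -(frobenius_inner_permute n rho T) -tensor_power_col_perm.
by rewrite -col_permM mulgV col_perm1.
Qed.

End PermuteTensor.
Arguments permute_tensor {R d n}.

(** * Permutation invariance of the standard Gaussian law *)

Section GaussianPermute.
Variable R : realType.
Local Open Scope classical_set_scope.

Local Notation RR := (measurableTypeR R).

Definition box d (A : 'I_d -> set RR) : set (d.-tuple RR) :=
  [set x | forall i, A i (tnth x i)].
Arguments box {d}.

Definition boxes d : set (set (d.-tuple RR)) :=
  [set B | exists2 A, (forall i, measurable (A i)) & B = box A].

Lemma measurable_box d (A : 'I_d -> set RR) :
  (forall i, measurable (A i)) -> measurable (box A).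
Proof.
move=> mA.
rewrite (_ : box A =
    \bigcap_(i in [set: 'I_d]) ((fun x => tnth x i) @^-1` A i)).
  apply: fin_bigcap_measurable => // i _.
  by rewrite -[X in measurable X]setTI; apply: measurable_tnth.
by apply/seteqP; split=> x /= H i; [move=> _|]; exact: H.
Qed.

Lemma boxesI d : setI_closed (boxes d).
Proof.
move=> _ _ [A mA ->] [B mB ->]; exists (fun i => A i `&` B i).
  by move=> i; exact: measurableI.
apply/seteqP; split => x; first by move=> [Ax Bx] i; split.
by move=> ABx; split=> i; case: (ABx i).
Qed.

Lemma boxes_setT d : boxes d setT.
Proof. by exists (fun=> setT) => //; apply/seteqP; split. Qed.

Lemma measurable_boxes d :
  measurable = <<s boxes d >> :> set (set (d.-tuple RR)).
Proof.
apply/seteqP; split; last first.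
  apply: smallest_sub; first exact: sigma_algebra_measurable.
  by move=> _ [A mA ->]; exact: measurable_box.
apply: smallest_sub; first exact: smallest_sigma_algebra.
move=> B; rewrite -bigcup_seq => -[i _ [A mA <-]].
apply: sub_sigma_algebra.
(* a condition on one coordinate is a box with all other sides full *)
exists (fun j => if j == i then A else setT) => [j|]; first by case: ifP.
rewrite setTI; apply/seteqP; split => x /=.
  by move=> Ax j; case: eqP => [->|].
by move=> /(_ i); rewrite eqxx.
Qed.

Definition permute_tuple d (rho : 'S_d) (x : d.-tuple RR) : d.-tuple RR :=
  [tuple tnth x (rho i) | i < d].
Arguments permute_tuple {d}.

Lemma measurable_permute_tuple d (rho : 'S_d) :
  measurable_fun setT (permute_tuple rho).
Proof.
apply/measurable_fun_tnthP => i.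
rewrite (_ : _ \o _ = fun x => tnth x (rho i)); first exact: measurable_tnth.
by apply/funext => x /=; rewrite tnth_mktuple.
Qed.

HB.instance Definition _ d (rho : 'S_d) :=
  isMeasurableFun.Build _ _ _ _ _ (measurable_permute_tuple d rho).

(** By uniqueness of measures it is enough to compare the two laws on boxes,
    where both are the same product in two orders. *)
Lemma standard_gaussian_permute d (rho : 'S_d) (B : set (d.-tuple RR)) :
  measurable B ->
  pushforward (standard_gaussian R d) (permute_tuple rho) B =
  standard_gaussian R d B.
Proof.
move=> mB.
apply: (measure_unique (boxes d) (fun=> setT) (measurable_boxes d) (boxesI d)
  _ _ (distribution (standard_gaussian R d) (permute_tuple rho))) => //.
- by move=> _; exact: boxes_setT.
- by apply: bigcup_const; exists 0%N.
- move=> _ [A mA ->].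
  transitivity (standard_gaussian R d (box (fun j => A ((rho^-1)%g j)))).
    congr (standard_gaussian R d _); apply/seteqP; split => x /= Ax i.
      by have := Ax ((rho^-1)%g i); rewrite tnth_mktuple permKV.
    by rewrite tnth_mktuple; have := Ax (rho i); rewrite permK.
  rewrite standard_gaussian_box //.
  transitivity (\prod_(i < d) normal_prob (0 : R) 1 (A i))%E.
    by rewrite [RHS](reindex_inj (@perm_inj _ (rho^-1)%g)).
  exact/esym/standard_gaussian_box.
- move=> _; apply: (le_lt_trans _ (ltry (1 : R))).
  exact: (probability_le1 (distribution _ _)).
Qed.

(** * Invariance of the norms *)

Lemma measurable_frobenius_inner_power d n (T : tensor R d n) :
  measurable_fun setT
    (fun x : d.-tuple RR =>
      frobenius_inner T (tensor_power n (\row_j tnth x j))).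
Proof.
apply: measurable_sum => i; apply: measurable_funM => //.
under eq_fun do rewrite ffunE.
apply: measurable_prod => a _.
under eq_fun do rewrite mxE.
exact: measurable_tnth.
Qed.

Lemma frobenius_inner_permute_tuple d n (rho : 'S_d) (T : tensor R d n)
    (x : d.-tuple RR) :
  frobenius_inner (permute_tensor rho T)
    (tensor_power n (\row_j tnth x j)) =
  frobenius_inner T
    (tensor_power n (\row_j tnth (permute_tuple (rho^-1)%g x) j)).
Proof.
rewrite frobenius_inner_permute_power; congr (frobenius_inner T _).
by congr tensor_power; apply/rowP => j; rewrite !mxE tnth_mktuple.
Qed.

(** Moving the permutation onto the Gaussian vector turns one integrand into the
    other composed with a coordinate permutation. Both arguments are the same
    tensor, so the integrand is a square and the change of variables for
    nonnegative functions applies. *)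
Lemma gaussian_inner_permute d (rho : 'S_d) (T : tensor R d 3) :
  gaussian_inner (permute_tensor rho T) (permute_tensor rho T) =
  gaussian_inner T T.
Proof.
pose f (x : d.-tuple RR) : \bar R :=
  (frobenius_inner T (tensor_power 3 (\row_j tnth x j)) *
   frobenius_inner T (tensor_power 3 (\row_j tnth x j)))%:E.
have f_ge0 x : (0 <= f x)%E by rewrite lee_fin -expr2 sqr_ge0.
have mf : measurable_fun setT f.
  apply/measurable_EFinP.
  by apply: measurable_funM; exact: measurable_frobenius_inner_power.
rewrite /gaussian_inner !expectation.unlock; congr fine.
transitivity (\int[standard_gaussian R d]_x
    (f \o permute_tuple (rho^-1)%g) x)%E.
  apply: eq_integral => x _; congr (_ * _)%:E;
    exact: frobenius_inner_permute_tuple.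
transitivity (\int[distribution (standard_gaussian R d)
    (permute_tuple (rho^-1)%g)]_x f x)%E.
  by apply/esym; apply: ge0_integral_pushforward.
by apply: eq_measure_integral => B mB _; exact: standard_gaussian_permute.
Qed.

Lemma tensor_norm_permute d n (star : inner_choice n) (rho : 'S_d)
    (T : tensor R d n) :
  tensor_norm star (permute_tensor rho T) = tensor_norm star T.
Proof.
rewrite /tensor_norm; case: star T => [m|] T /=; congr Num.sqrt.
  exact: frobenius_inner_permute.
exact: gaussian_inner_permute.
Qed.

End GaussianPermute.

Theorem mainTheorem2 (R : realType) (k h d n : nat)
    (k_gt0 : (0 < k)%N) (h_gt0 : (0 < h)%N) (d_gt0 : (0 < d)%N) (n_gt0 : (0 < n)%N)
    (star : inner_choice n) (V : 'M[R]_(h, d)) (sigma : 'S_h) (rho : 'S_d)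
    (V_symmetry : V *m permutation_matrix R rho = permutation_matrix R sigma *m V)
    (W : 'M[R]_(k, d)) :
  loss star V W = loss star V (W *m permutation_matrix R rho).
Proof.
rewrite /loss -(residual_row_permutation _ _ n k h sigma V (W *m _)).
by rewrite -V_symmetry residual_mul_permutation tensor_norm_permute.
Qed.
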